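(* Let $p$ be an odd prime and $g\ge 1$. Let $G$ be a finite abelian $p$-group of $p$-class $c$ and generator rank $g$. Then $$\mathrm{Meas}_c^{\mathrm{ab}}(G)=\frac{1}{|\mathrm{Aut}(G)|\,|G|}\,p^{g(g+1)}\prod_{k=1}^{g}(1-p^{-k})\prod_{k=g+2-u}^{g+1}(1-p^{-k}),$$ where $u$ is the number of cyclic groups of order strictly less than $p^c$ in the direct product decomposition of $G$ into cyclic groups. Moreover, for every $c'>c$, $$\mathrm{Meas}_{c'}^{\mathrm{ab}}(G)=\frac{1}{|\mathrm{Aut}(G)|\,|G|}\,p^{g(g+1)}\prod_{k=1}^{g}(1-p^{-k})\prod_{k=2}^{g+1}(1-p^{-k}).$$
   Context: Let $F$ be the free pro-$p$ group on $g$ generators and $F^{\mathrm{ab}}$ its abelianization. For a pro-$p$ group $H$, the lower $p$-central series is $P_0(H)=H$, $P_{n+1}(H)=[H,P_n(H)]P_n(H)^p$ (closed subgroups); $H$ has $p$-class $c$ if $P_c(H)=1$ but $P_n(H)\neq 1$ for $n<c$. Put $F_{c'}^{\mathrm{ab}}=F^{\mathrm{ab}}/P_{c'}(F^{\mathrm{ab}})$, and let $\Phi(\cdot)$ denote the Frattini subgroup. For a finite abelian $p$-group $G$ of $p$-class $c$ and generator rank $g$ and $c'\ge c$, a tuple $v=(t_1,\dots,t_{g+1})\in\Phi(F_{c'}^{\mathrm{ab}})^{g+1}$ presents $G$ if $F_{c'}^{\mathrm{ab}}/\langle t_1,\dots,t_{g+1}\rangle\cong G$; let $S_{c'}^{\mathrm{ab}}(G)$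 be the set of such tuples. The abelian$+1$ $c'$-measure is $\mathrm{Meas}_{c'}^{\mathrm{ab}}(G)=|S_{c'}^{\mathrm{ab}}(G)|/|\Phi(F_{c'}^{\mathrm{ab}})|^{g+1}$. *)

(* Defs.v *)
From HB Require Import structures.
From mathcomp Require Import all_boot all_order all_algebra all_fingroup all_solvable.
Set Implicit Arguments. Unset Strict Implicit. Unset Printing Implicit Defensive.
Import GroupScope.

Fixpoint lower_pcentral (gT : finGroupType) (p : nat) (H : {set gT}) (n : nat)
  : {set gT} :=
  match n with
  | 0 => H
  | n'.+1 =>
      let P := lower_pcentral p H n' in
      [~: H, P] <*> <<[set x ^+ p | x in P]>>
  end.

Definition has_pclass (gT : finGroupType) (p : nat) (H : {set gT}) (c : nat) :=
  lower_pcentral p H c = 1 /\ forall n, n < c -> lower_pcentral p H n != 1.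

Definition has_gen_rank (gT : finGroupType) (H : {set gT}) (g : nat) :=
  (exists X : {set gT}, #|X| = g /\ <<X>> = H) /\
  (forall X : {set gT}, <<X>> = H -> g <= #|X|).

(* F_{c'}^{ab} = F^{ab} / P_{c'}(F^{ab}), where F^{ab} = Z_p^g;
   concretely the additive group (Z / p^{c'} Z)^g. *)
Definition Fab (p g c' : nat) := 'rV['Z_(p ^ c')]_g.

Definition Sab (p g c' : nat) (gT : finGroupType) (G : {group gT}) :
  {set {ffun 'I_g.+1 -> Fab p g c'}} :=
  [set v : {ffun 'I_g.+1 -> Fab p g c'} |
     [forall i, v i \in 'Phi([set: Fab p g c'])] &&
     ([set: Fab p g c'] / <<[set v i | i in 'I_g.+1]>> \isog G)].

Definition Meas_ab (p g c' : nat) (gT : finGroupType) (G : {group gT}) : rat :=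
  (#|Sab p g c' G|%:R / (#|'Phi([set: Fab p g c'])| ^ g.+1)%:R)%R.

(* Main.v *)
(* Let A = (Z/p^c')^g. Generating g-tuples t of G are the same as surjections
   A -> G, and we count the pairs (v, t) in which the (g+1)-tuple v generates the
   kernel K_t. For fixed v presenting G there are |Aut G| such t. For fixed t
   there are |K_t|^(g+1) prod_{g+2-r <= k <= g+1} (1 - p^-k) such v, where r is
   the rank of K_t: an n-tuple generates an abelian p-group R iff its image
   spans R / Phi(R). The same count gives the number
   |G|^g prod_{1 <= k <= g} (1 - p^-k) of tuples t. Finally |K_t| = |A| / |G|,
   and r + log_p |p^(c'-1) G| = g, so r = u when c' = c and r = g when c' > c. *)
Require Import Defs.
From HB Require Import structures.
From mathcomp Require Import all_boot all_order all_algebra all_fingroup all_solvable.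
From mathcomp Require mxabelem.
From mathcomp Require Import ring.
Import GRing.Theory Num.Theory.
Set Implicit Arguments.
Unset Strict Implicit.
Unset Printing Implicit Defensive.
Local Open Scope group_scope.

(** * Counting generating tuples *)

Definition gentuples (gT : finGroupType) (n : nat) (H : {set gT}) :
  {set {ffun 'I_n -> gT}} :=
  [set f : {ffun 'I_n -> gT} | <<[set f i | i in 'I_n]>> == H].

Lemma gentuples_in (gT : finGroupType) (n : nat) (H : {set gT}) f :
  f \in gentuples n H -> forall i, f i \in H.
Proof.
by rewrite inE => /eqP <- i; rewrite mem_gen //; apply/imsetP; exists i.
Qed.

(** Whether [f] generates [H] together with [N] depends only on its classes modulo [N], and each
    tuple of [H / N] has |N|^n lifts. *)
Lemma card_gentuples_mod (gT : finGroupType) n (H N : {group gT}) : N <| H ->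
  #|[set f : {ffun 'I_n -> gT} | N <*> <<[set f i | i in 'I_n]>> == H]| =
  (#|N| ^ n * #|gentuples n (H / N)|)%N.
Proof.
move=> nNH; have sHN := normal_norm nNH; have sNH := normal_sub nNH.
set S := [set f | _]; pose q (f : {ffun 'I_n -> gT}) := [ffun i => coset N (f i)].
have imq (f : {ffun 'I_n -> gT}) :
    [set q f i | i in 'I_n] = coset N @: [set f i | i in 'I_n].
  by rewrite -imset_comp; apply: eq_imset => i; rewrite /= ffunE.
have SP (f : {ffun 'I_n -> gT}) : (forall i, f i \in 'N(N)) ->
    (f \in S) = (q f \in gentuples n (H / N)).
  move=> Nf; rewrite !inE imq.
  have sX : [set f i | i in 'I_n] \subset 'N(N) by apply/subsetP=> _ /imsetP[i _ ->].
  have -> : coset N @: [set f i | i in 'I_n] = [set f i | i in 'I_n] / N.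
    by rewrite quotientE morphimEsub.
  rewrite -quotient_gen // -(quotientYidl (G := <<_>>)) ?gen_subG //.
  apply/eqP/eqP => [-> // | ]; apply: (quotient_inj (G1 := _ <*> _)) => //.
  by rewrite /normal joing_subl join_subG normG gen_subG.
rewrite -sum1_card (partition_big q [in gentuples n (H / N)]) /=; last first.
  move=> f Sf; rewrite -SP // => i; apply: (subsetP sHN).
  move: Sf; rewrite inE => /eqP <-; apply: (subsetP (joing_subr _ _)).
  by rewrite mem_gen //; apply/imsetP; exists i.
rewrite mulnC -sum_nat_const; apply: eq_bigr => h Th; rewrite sum1_card.
(* The fibre over [h] is the product of the cosets [h i], read as subsets of [gT]. *)
have famE : [pred f | (f \in S) && (q f == h)] =i
    family (fun i => [in (h i : {set gT})]).
  move=> f; rewrite !inE; apply/andP/familyP => [[Sf /eqP<- i] | hf].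
    rewrite /= ffunE val_coset ?rcoset_refl //.
    apply: (subsetP sHN).
    move: Sf; rewrite /= => /eqP <-; apply: (subsetP (joing_subr _ _)).
    by rewrite mem_gen //; apply/imsetP; exists i.
  have qf : q f = h by apply/ffunP=> i; rewrite ffunE; apply: coset_mem; exact: hf.
  split; last exact/eqP.
  have := SP f; rewrite inE qf Th => -> // i.
  exact: (subsetP (coset_norm (h i))) (hf i).
rewrite (eq_card famE) card_family foldrE big_map big_enum /=.
rewrite (eq_bigr (fun=> #|N|)) ?prod_nat_const ?card_ord // => i _.
have /morphimP[x Nx _ ->] : h i \in 'N(N) / N.
  by apply: (subsetP (quotientS _ sHN)); apply: gentuples_in Th i.
by rewrite val_coset // card_rcoset.
Qed.

(** Sorting by the first entry [x] prepares an induction on the length: for normal [<[x]>],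
    [card_gentuples_mod] turns the summand into a count in [H / <[x]>]. *)
Lemma card_gentuples_recl (gT : finGroupType) n (H : {set gT}) :
  #|gentuples n.+1 H| =
  (\sum_(x in H)
     #|[set f : {ffun 'I_n -> gT} | <[x]> <*> <<[set f i | i in 'I_n]>> == H]|)%N.
Proof.
rewrite -sum1_card (partition_big (fun f : {ffun 'I_n.+1 -> gT} => f ord0) [in H]).
2: by move=> f /gentuples_in; apply.
apply: eq_bigr => x _; rewrite sum1_card.
pose h (f : {ffun 'I_n -> gT}) := [ffun i => oapp f x (unlift ord0 i)].
have hl f i : h f (lift ord0 i) = f i by rewrite ffunE liftK.
have h0 f : h f ord0 = x by rewrite ffunE unlift_none.
have injh : injective h by move=> f1 f2 e; apply/ffunP=> i; rewrite -!hl e.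
rewrite -(card_imset _ injh); apply: eq_card => f.
have im_h k : [set h k i | i in 'I_n.+1] = x |: [set k i | i in 'I_n].
  apply/setP=> y; rewrite !inE; apply/imsetP/orP.
    case=> i _ ->; case: (unliftP ord0 i) => [j|] ->; rewrite ?h0 ?hl; last by left.
    by right; apply/imsetP; exists j.
  case=> [/eqP->|/imsetP[j _ ->]]; first by exists ord0; rewrite ?h0.
  by exists (lift ord0 j); rewrite ?hl.
apply/andP/imsetP => [[Gf /eqP f0] | [k Sk ->]].
  pose k := [ffun i => f (lift ord0 i)].
  have fE : f = h k.
    apply/ffunP=> i; case: (unliftP ord0 i) => [j|] ->; last by rewrite h0.
    by rewrite hl ffunE.
  exists k => //; move: Gf; rewrite fE !inE im_h => /eqP <-.
  by rewrite /cycle joing_idl joing_idr.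
split; last by rewrite h0.
by move: Sk; rewrite !inE im_h /cycle joing_idl joing_idr.
Qed.

(** Here ['Phi(R)] is the image of the p-th power map, and its kernel ['Ohm_1(R)] has order p^r with
    r the rank. *)
Lemma card_Phi_abelian (p : nat) (gT : finGroupType) (R : {group gT}) :
  p.-group R -> abelian R -> (#|'Phi(R)| * p ^ 'r(R))%N = #|R|.
Proof.
move=> pR cRR; rewrite (Phi_Mho pR cRR) -(mul_card_Ohm_Mho_abelian 1 cRR) mulnC.
by rewrite (rank_abelian_pgroup pR cRR) -card_pgroup // (pgroupS (Ohm_sub _ _)).
Qed.

Local Open Scope ring_scope.

(** This is the number of r x n matrices of rank r over F_p, where |E| = p^r. For n < r the factor i
    = n makes it vanish. *)
Lemma card_gentuples_abelem (p n : nat) (gT : finGroupType) (E : {group gT}) :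
  prime p -> (p.-abelem E)%g ->
  #|gentuples n E|%:R = \prod_(i < logn p #|E|) ((p ^ n)%:R - (p ^ i)%:R) :> rat.
Proof.
move=> p_pr; elim: n gT E => [|n IHn] gT E abE.
  have -> : #|gentuples 0 E| = (E :==: 1%g).
    have imf0 (f : {ffun 'I_0 -> gT}) : [set f i | i in 'I_0] = set0.
      by apply/setP=> x; rewrite inE; apply/imsetP => -[[]].
    case: eqP => [E1|/eqP nE1].
      rewrite (_ : gentuples _ _ = setT) ?cardsT ?card_ffun ?card_ord //.
      by apply/setP=> f; rewrite !inE imf0 gen0 E1 eqxx.
    rewrite (_ : gentuples _ _ = set0) ?cards0 //.
    by apply/setP=> f; rewrite !inE imf0 gen0 eq_sym (negPf nE1).
  have [E1|nE1] := eqVneq (E : {set gT}) 1%g.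
    by rewrite E1 cards1 logn1 big_ord0.
  have /p_natP[[|r] cE] := abelem_pgroup abE.
    by case/eqP: nE1; apply: card1_trivg.
  by rewrite cE pfactorK // big_ord_recl subrr mul0r.
have nE x : x \in E -> (<[x]> <| E)%g.
  by move=> Ex; rewrite -sub_abelian_normal ?(abelem_abelian abE) ?cycle_subG.
have IHx x : x \in E ->
    #|[set f : {ffun 'I_n -> gT} | <[x]> <*> <<[set f i | i in 'I_n]>> == E]|%g%:R
    = (#[x]%g ^ n)%:R * \prod_(i < logn p #|E / <[x]>|%g) ((p ^ n)%:R - (p ^ i)%:R) :> rat.
  move=> Ex; rewrite card_gentuples_mod ?nE // natrM IHn //.
  exact: quotient_abelem.
have p0 : (p%:R : rat) != 0 by rewrite pnatr_eq0 -lt0n prime_gt0.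
have [r cE] := p_natP (abelem_pgroup abE).
(* A first entry 1 leaves all of [E] to generate; any other has order p and leaves a quotient of
   rank one less. *)
rewrite card_gentuples_recl natr_sum (eq_bigr _ IHx) cE pfactorK // (bigD1 1%g) //=.
have cEx x : x \in E -> #|E / <[x]>|%g = (p ^ r %/ #[x]%g)%N.
  by move=> Ex; rewrite card_quotient ?normal_norm ?nE // -divgS ?cycle_subG // cE.
rewrite cEx ?group1 // order1 exp1n mul1r divn1 pfactorK //.
case: r cE cEx => [|r] cE cEx.
  rewrite !big_ord0 big1 ?addr0 // => x /andP[Ex /negP[]].
  by move: Ex; rewrite (card1_trivg cE) => /set1gP/eqP.
rewrite [X in _ + X](eq_bigr
  (fun=> (p ^ n)%:R * \prod_(i < r) ((p ^ n)%:R - (p ^ i)%:R))); last first.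
  move=> x /andP[Ex nx]; rewrite cEx // (abelem_order_p abE Ex nx).
  by rewrite expnS mulKn ?prime_gt0 // pfactorK.
have -> : \sum_(x in E | x != 1%g) (p ^ n)%:R * \prod_(i < r) ((p ^ n)%:R - (p ^ i)%:R)
   = ((p ^ r.+1)%:R - 1) * ((p ^ n)%:R * \prod_(i < r) ((p ^ n)%:R - (p ^ i)%:R)) :> rat.
  rewrite sumr_const -[in RHS]cE (cardsD1 1%g E) group1 addnC natrD addrK [RHS]mulr_natl.
  by congr (_ *+ _); apply: eq_card => x; rewrite !inE andbC.
rewrite big_ord_recr [in RHS]big_ord_recl /= expn0.
have -> : \prod_(i < r) ((p ^ n.+1)%:R - (p ^ bump 0 i)%:R) =
    (p ^ r)%:R * \prod_(i < r) ((p ^ n)%:R - (p ^ i)%:R) :> rat.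
  have -> : (p ^ r)%:R = \prod_(i < r) p%:R :> rat by rewrite prodr_const card_ord natrX.
  rewrite -big_split /=.
  by apply: eq_bigr => i _; rewrite /bump leq0n add1n !expnS !natrM mulrBr.
rewrite !expnS !natrM; ring.
Qed.

(** p^n - p^i = p^n (1 - p^-(n - i)), and k = n - i runs down from n to n + 1 - r. *)
Lemma prod_expn_sub (p n r : nat) : (0 < p)%N -> (r <= n)%N ->
  \prod_(i < r) ((p ^ n)%:R - (p ^ i)%:R) =
    ((p ^ n) ^ r)%:R * \prod_(n.+1 - r <= k < n.+1) (1 - p%:R ^- k) :> rat.
Proof.
move=> p_gt0; elim: r => [|r IHr] lt_rn; first by rewrite big_ord0 subn0 big_geq ?mulr1.
have p0 : (p%:R : rat) != 0 by rewrite pnatr_eq0 -lt0n.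
rewrite big_ord_recr /= IHr 1?ltnW // subSS [in RHS]big_ltn ?ltnS ?leq_subr //.
rewrite -subSn 1?ltnW //.
rewrite expnSr natrM -[in (p ^ n)%:R - _](subnK (ltnW lt_rn)) expnD natrM.
rewrite -[in X in _ = _ * X * _](subnK (ltnW lt_rn)) expnD natrM !natrX.
have := expf_neq0 (n - r) p0; set P := _ ^+ (n - r) => P0.
by field.
Qed.

(** Elements of ['Phi(R)] are non-generators, so the count reduces to the elementary abelian
    [R / 'Phi(R)] of order p^r; the powers of p recombine with |Phi(R)|^n into |R|^n. *)
Lemma card_gentuples_pgroup (p n : nat) (gT : finGroupType) (R : {group gT}) :
  prime p -> (p.-group R)%g -> abelian R -> ('r(R)%g <= n)%N ->
  #|gentuples n R|%:R =
    (#|R| ^ n)%:R * \prod_(n.+1 - 'r(R)%g <= k < n.+1) (1 - p%:R ^- k) :> rat.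
Proof.
move=> p_pr pR cRR; set r := 'r(R)%g => le_rn.
have cPhi : #|R / 'Phi(R)|%g = (p ^ r)%N.
  rewrite card_quotient ?gFnorm // -divgS ?Phi_sub //=.
  by rewrite -{1}(card_Phi_abelian pR cRR) mulKn ?cardG_gt0.
have -> : gentuples n R =
    [set f : {ffun 'I_n -> gT} | ('Phi(R) <*> <<[set f i | i in 'I_n]>>)%g == R].
  apply/setP=> f; rewrite !inE.
  apply/eqP/eqP => [-> | /Phi_nongen]; last by rewrite genGid.
  by apply/joing_idPr; exact: Phi_sub.
rewrite card_gentuples_mod ?Phi_normal // natrM.
rewrite (card_gentuples_abelem n p_pr) ?Phi_quotient_abelem // cPhi pfactorK //.
rewrite -(card_Phi_abelian pR cRR) -/r expnMn natrM -mulrA; congr (_ * _).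
rewrite -expnM mulnC expnM; by apply: prod_expn_sub; rewrite ?prime_gt0.
Qed.

Local Close Scope ring_scope.

(** * Homomorphisms from (Z/q)^g attached to tuples *)

Definition tuple_hom (q g : nat) (gT : finGroupType) (t : {ffun 'I_g -> gT})
  (v : 'rV['Z_q]_g) : gT := \prod_(i < g) t i ^+ (v ord0 i).

Lemma prod_mulg_abelian (gT : finGroupType) (G : {group gT}) (I : Type)
    (s : seq I) (x y : I -> gT) : abelian G ->
  (forall i, x i \in G) -> (forall i, y i \in G) ->
  \prod_(i <- s) (x i * y i) = \prod_(i <- s) x i * \prod_(i <- s) y i.
Proof.
move=> cGG Gx Gy; elim: s => [|i s IHs]; first by rewrite !big_nil mulg1.
rewrite !big_cons IHs !mulgA; congr (_ * _); rewrite -!mulgA; congr (_ * _).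
by apply: (centsP cGG) => //; apply: group_prod.
Qed.

(** Residues modulo q may serve as exponents because the order of each [t i] divides q. The bound
    [1 < q] makes ['Z_q] really Z/q: for smaller q it is Z/2. *)
Lemma tuple_homM q g (gT : finGroupType) (G : {group gT}) (t : {ffun 'I_g -> gT}) :
  abelian G -> exponent G %| q -> (1 < q)%N -> (forall i, t i \in G) ->
  {in [set: 'rV['Z_q]_g] &, {morph tuple_hom (q := q) t : u v / u * v}}.
Proof.
move=> cGG eG q1 Gt u v _ _; rewrite /tuple_hom.
rewrite -(prod_mulg_abelian _ cGG); try by move=> i; apply: groupX.
apply: eq_bigr => i _; rewrite -expgD mxE /= [X in _ %% X]Zp_cast // expg_mod //.
by apply/eqP; rewrite -order_dvdn (dvdn_trans _ eG) // dvdn_exponent.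
Qed.

Lemma tuple_hom_delta q g (gT : finGroupType) (t : {ffun 'I_g -> gT}) i :
  tuple_hom (q := q) t (delta_mx ord0 i) = t i.
Proof.
have tE j : t j ^+ (delta_mx ord0 i : 'rV['Z_q]_g) ord0 j = if j == i then t j else 1.
  by rewrite mxE eqxx /=; case: eqP => _ //=; rewrite /= modn_small ?expg1.
rewrite /tuple_hom (eq_bigr _ (fun j _ => tE j)).
by rewrite -big_mkcond big_pred1_eq.
Qed.

Lemma morph_tuple_hom q g (gT : finGroupType) (h : 'rV['Z_q]_g -> gT) :
  {morph h : u v / u * v} -> forall v, h v = tuple_hom [ffun i => h (delta_mx ord0 i)] v.
Proof.
move=> hM v; have h1 : h 1 = 1.
  by apply: (@mulgI _ (h 1)); rewrite -hM !mulg1.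
have hX u n : h (u ^+ n) = h u ^+ n.
  by elim: n => [|n IHn]; rewrite ?expg0 // !expgS hM IHn.
rewrite {1}[v]row_sum_delta /tuple_hom (big_morph h hM h1).
apply: eq_bigr => i _; rewrite ffunE -hX.
by rewrite -{1}[v ord0 i]natr_Zp scaler_nat FinRing.zmodXgE.
Qed.

Lemma gentuples_morphism q g (gT : finGroupType) (G : {group gT}) t :
  abelian G -> exponent G %| q -> (1 < q)%N -> t \in gentuples g G ->
  exists f : {morphism [set: 'rV['Z_q]_g] >-> gT},
    [/\ f =1 tuple_hom t, 'ker f = [set v | tuple_hom t v == 1] & f @* setT = G].
Proof.
move=> cGG eG q1 Gt; have Gti := gentuples_in Gt.
pose f := Morphism (tuple_homM cGG eG q1 Gti).
exists f; split=> //.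
  by apply/setP=> v; rewrite !inE.
apply/eqP; rewrite eqEsubset; apply/andP; split.
  apply/subsetP=> _ /morphimP[v _ _ ->]; apply: group_prod => i _.
  exact: groupX.
move: Gt; rewrite inE => /eqP <-; rewrite gen_subG.
apply/subsetP=> _ /imsetP[i _ ->]; apply/morphimP.
by exists (delta_mx ord0 i); rewrite ?inE //= tuple_hom_delta.
Qed.

(* Any two generating tuples with the same kernel differ by a unique automorphism
   of [G]. *)
Lemma card_gentuples_ker q g (gT : finGroupType) (G : {group gT})
    (R : {group 'rV['Z_q]_g}) :
  abelian G -> exponent G %| q -> (1 < q)%N -> [set: 'rV['Z_q]_g] / R \isog G ->
  #|[set t in gentuples g G | [set v | tuple_hom (q := q) t v == 1] == R]| = #|Aut G|.
Proof.
move=> cGG eG q1 /isogP[f0 injf0 imf0].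
have nR v : v \in 'N(R).
  have cAA := FinRing.zmod_abelian [set: 'rV['Z_q]_g].
  by apply: (subsetP (sub_abelian_norm cAA (subsetT R))); rewrite inE.
have qA v : coset R v \in [set: 'rV['Z_q]_g] / R by rewrite mem_quotient ?inE.
(* Reference tuple: the images of the standard basis under A -> A / R -> G, where A is the whole
   group. *)
pose t0 := [ffun i : 'I_g => f0 (coset R (delta_mx ord0 i))].
have t0E v : tuple_hom t0 v = f0 (coset R v).
  rewrite (morph_tuple_hom (h := fun v => f0 (coset R v))) // => u w.
  by rewrite morphM ?nR // morphM ?qA.
have Gt0 : t0 \in gentuples g G.
  rewrite inE eqEsubset gen_subG; apply/andP; split.
    apply/subsetP=> _ /imsetP[i _ ->]; rewrite ffunE -imf0; exact: mem_morphim.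
  rewrite -imf0; apply/subsetP=> _ /morphimP[_ _ /morphimP[v _ _ ->] ->].
  rewrite -t0E; apply: group_prod => i _; apply: groupX; apply: mem_gen.
  by apply/imsetP; exists i.
have [h0 [h0E kh0 imh0]] := gentuples_morphism cGG eG q1 Gt0.
have kerR : [set v | tuple_hom (q := q) t0 v == 1] = R.
  apply/setP=> v; rewrite inE t0E morph_injm_eq1 //.
  by apply/eqP/idP => [/coset_idr -> //| /coset_id].
rewrite kerR in kh0.
pose F (a : {perm gT}) := [ffun i => a (t0 i)].
have FE (a : {perm gT}) v : a \in Aut G -> a (tuple_hom t0 v) = tuple_hom (F a) v.
  move=> Aa; rewrite -(autmE Aa) morph_prod => [|i _]; last exact/groupX/gentuples_in.
  apply: eq_bigr => i _; rewrite [F a i]ffunE morphX ?autmE //.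
  exact: gentuples_in Gt0 i.
have injF : {in Aut G &, injective F}.
  move=> a b Aa Ab eF; apply: (eq_Aut Aa Ab) => x.
  rewrite -imh0 => /morphimP[v _ _ ->]; rewrite h0E.
  by rewrite !FE // eF.
rewrite -(card_in_imset injF); apply: eq_card => t.
rewrite inE; apply/andP/imsetP => [[Gt /eqP kt] | [a Aa ->]].
  have [h [hE kh imh]] := gentuples_morphism cGG eG q1 Gt.
  rewrite kt in kh.
  have sK : 'ker h0 \subset 'ker h by rewrite kh0 kh.
  have sGi : G \subset h0 @* setT by rewrite imh0.
  (* Equal kernels let [h] factor through [h0]; the factor [b] is the automorphism with b(h0 v) = h
     v. *)
  pose b := restrm sGi (factm sK (subxx _)).
  have injb : 'injm b.
    by apply: injm_restrm; rewrite ker_factm kh -kh0 morphim_ker.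
  have imb : b @* G = G.
    by rewrite morphim_restrm setIid -{1}imh0 morphim_factm imh.
  exists (aut injb imb); first exact: Aut_aut.
  apply/ffunP=> i; rewrite ffunE autE; last exact: gentuples_in Gt0 i.
  have := factmE sK (subxx _) (in_setT (delta_mx ord0 i)).
  by rewrite h0E hE !tuple_hom_delta => <-.
have Ga i : F a i \in G by rewrite ffunE -(autmE Aa) Aut_closed ?(gentuples_in Gt0).
split; last first.
  rewrite -kerR; apply/eqP/setP=> v; rewrite !inE -FE // -(autmE Aa).
  rewrite morph_injm_eq1 ?injm_autm //; apply: group_prod => i _.
  exact/groupX/gentuples_in.
rewrite inE eqEsubset gen_subG; apply/andP; split.
  by apply/subsetP=> _ /imsetP[i _ ->].
rewrite -{1}(im_autm Aa); apply/subsetP=> _ /morphimP[x _ Gx ->] /=.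
have /morphimP[v _ _ ->] : x \in h0 @* setT by rewrite imh0.
rewrite h0E autmE FE //; apply: group_prod => i _; apply: groupX; apply: mem_gen.
by apply/imsetP; exists i.
Qed.

(** * Frattini subgroup, power subgroups and abelian type *)

(** By equality of ranks, [A] and [A / R] have Frattini quotients of the same order; as
    ['Phi(A / R)] is the image of ['Phi(A)], joining [R] to ['Phi(A)] does not enlarge it. *)
Lemma Phi_sub_rank_quotient (p : nat) (gT : finGroupType) (A R : {group gT}) :
  p.-group A -> abelian A -> R \subset A -> 'r(A / R) = 'r(A) -> R \subset 'Phi(A).
Proof.
move=> pA cAA sRA rAR; have nRA : R <| A by rewrite -sub_abelian_normal.
have nR := normal_norm nRA.
have cPR : #|'Phi(A) <*> R| = #|'Phi(A)|.
  have nRP : 'Phi(A) \subset 'N(R) by apply: subset_trans (Phi_sub A) nR.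
  have e1 := card_Phi_abelian (quotient_pgroup R pA) (quotient_abelian R cAA).
  rewrite -(quotient_Phi pA nR) rAR in e1.
  have e2 := card_Phi_abelian pA cAA.
  have := Lagrange sRA; rewrite -card_quotient // -e1 -e2 mulnA => /eqP.
  have p_gt0 : 0 < p ^ 'r(A).
    by rewrite -(ltn_pmul2l (m := #|'Phi(A)|)) ?cardG_gt0 // muln0 e2 cardG_gt0.
  rewrite eqn_pmul2r // -quotientYidr // card_quotient ?join_subG ?nRP ?normG //.
  by rewrite Lagrange ?joing_subr // => /eqP.
have /eqP-> : 'Phi(A) == 'Phi(A) <*> R by rewrite eqEcard joing_subl cPR leqnn.
exact: joing_subr.
Qed.

(** Commutators vanish, and the p-th powers of a subgroup of [G] already form a subgroup. Hence
    p-class c means exponent p^c. *)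
Lemma lower_pcentral_abelian (p : nat) (gT : finGroupType) (G : {group gT}) n :
  p.-group G -> abelian G -> lower_pcentral p G n = 'Mho^n(G).
Proof.
move=> pG cGG; elim: n => [|n IHn] /=; first by rewrite Mho0.
rewrite IHn; have sM := Mho_sub n G.
have -> : [~: G, 'Mho^n(G)] = 1.
  by apply/commG1P; apply: subset_trans cGG _; apply: centS.
rewrite joing1G /= (_ : imset _ _ = 'Mho^n.+1(G)) /= ?genGid //.
rewrite !(MhoEabelian _ pG cGG) -imset_comp; apply: eq_imset => x /=.
by rewrite -expgM -expnSr.
Qed.

(** A cyclic factor of order p^(c+1) contributes one factor p to the order of ['Mho^c(G)], a smaller
    one nothing; so the logarithm counts the factors of full order. *)
Lemma count_abelian_type_lt (p c : nat) (gT : finGroupType) (G : {group gT}) :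
  prime p -> p.-group G -> abelian G -> 'Mho^c.+1(G) = 1 ->
  (count (fun m => m < p ^ c.+1) (abelian_type G) + logn p #|'Mho^c(G)| = 'r(G))%N.
Proof.
move=> p_pr pG cGG Mc; have [b defG ob] := abelian_structure cGG.
rewrite -size_abelian_type // -(count_predC (fun m => m < p ^ c.+1)); congr (_ + _)%N.
have := count_logn_dprod_cycle p c defG.
(* As ['Ohm_c.+1(G)] is [G], its index over ['Ohm_c(G)] is the order of ['Mho^c(G)]. *)
have /eqP-> : 'Ohm_c.+1(G) == G by rewrite trivg_Mho // Mc.
rewrite -divgS ?Ohm_sub // -(mul_card_Ohm_Mho_abelian c cGG) mulKn ?cardG_gt0 // => <-.
rewrite -ob count_map; apply: eq_in_count => x bx /=.
have Gx : x \in G.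
  rewrite -(bigdprodWY defG) mem_gen //; elim: (b) bx => // y s IHs.
  rewrite inE big_cons inE; case: eqP => [->|_ /IHs ->]; last exact: orbT.
  by rewrite cycle_id.
have /p_natP[k ->] : p.-nat #[x] by apply: mem_p_elt Gx.
by rewrite pfactorK // ltn_exp2l ?prime_gt1 // -leqNgt.
Qed.

(** * Double counting of presentations *)

(* Both sides count the pairs (v, t) where v generates the kernel of the
   surjection attached to the generating tuple t of [G]. *)
Lemma card_presentations n q g (gT : finGroupType) (G : {group gT}) :
  abelian G -> exponent G %| q -> (1 < q)%N ->
  (#|[set v : {ffun 'I_n -> 'rV['Z_q]_g} |
      ([set: 'rV['Z_q]_g] / <<[set v i | i in 'I_n]>> \isog G)%g]| * #|Aut G| =
   \sum_(t in gentuples g G) #|gentuples n [set v | tuple_hom (q := q) t v == 1%g]|)%N.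
Proof.
move=> cGG eG q1; set S := [set v | _].
transitivity (\sum_(v : {ffun 'I_n -> 'rV['Z_q]_g})
  #|[set t in gentuples g G |
     [set w | tuple_hom (q := q) t w == 1%g] == <<[set v i | i in 'I_n]>>]|)%N.
  rewrite -sum_nat_const big_mkcond; apply: eq_bigr => v _; rewrite inE.
  case: ifPn => [isoG | niso]; first by rewrite card_gentuples_ker.
  apply/esym/eqP; rewrite cards_eq0 -subset0; apply/subsetP=> t.
  rewrite inE => /andP[Gt /eqP kt]; case/negP: niso; rewrite -kt.
  have [h [hE <- <-]] := gentuples_morphism cGG eG q1 Gt.
  exact: first_isog.
under [RHS]eq_bigr => t _ do rewrite -sum1_card big_mkcond /=.
rewrite exchange_big; apply: eq_bigr => v _ /=.
rewrite -big_mkcondr sum1_card; apply: eq_card => t.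
by rewrite -[RHS]/((t \in _) && _) !inE; congr andb; rewrite eq_sym.
Qed.

(** * Order and rank of the kernels in (Z/p^(e+1))^g *)

Lemma card_rV_Zp q g : 1 < q -> #|[set: 'rV['Z_q]_g]| = (q ^ g)%N.
Proof. by move=> q1; rewrite cardsT card_mx card_ord Zp_cast // mul1n. Qed.

Lemma rV_Zp_pgroup p e g : prime p -> p.-group [set: 'rV['Z_(p ^ e.+1)]_g].
Proof.
move=> p_pr; have q1 : 1 < p ^ e.+1 by rewrite -(exp1n e.+1) ltn_exp2r ?prime_gt1.
by rewrite /pgroup card_rV_Zp // !pnatX pnat_id.
Qed.

(* The rank of [K] is read off the p-torsion [K :&: 'Ohm_1(A)], where A is the
   whole group: [A] is homocyclic of exponent p^(e+1), so 'Ohm_1(A) = 'Mho^e(A)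
   has rank g and is mapped onto 'Mho^e(G). *)
Lemma card_rank_tuple_ker p e g (gT : finGroupType) (G : {group gT}) t
    (K : {group 'rV['Z_(p ^ e.+1)]_g}) :
  prime p -> 0 < g -> abelian G -> exponent G %| p ^ e.+1 -> t \in gentuples g G ->
  K :=: [set v | tuple_hom t v == 1] ->
  (#|K| * #|G| = (p ^ e.+1) ^ g)%N /\ ('r(K) + logn p #|'Mho^e(G)| = g)%N.
Proof.
move=> p_pr g_gt0 cGG eG Gt kerK.
have q1 : 1 < p ^ e.+1 by rewrite -(exp1n e.+1) ltn_exp2r ?prime_gt1.
pose A := [set: 'rV['Z_(p ^ e.+1)]_g]%G.
have pA : p.-group A by apply: rV_Zp_pgroup.
have cAA : abelian A by apply: FinRing.zmod_abelian.
have cardA : #|A| = ((p ^ e.+1) ^ g)%N by apply: card_rV_Zp.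
have [h [_ kh imh]] := gentuples_morphism cGG eG q1 Gt; rewrite -kerK in kh.
have sKA : K \subset A by apply: subsetT.
split.
  have := card_isog (first_isog h); rewrite kh /= imh => <-.
  by rewrite card_quotient -?kh ?ker_norm //= kh Lagrange ?subsetT.
have pK := pgroupS sKA pA; have cKK := abelianS sKA cAA.
have rA : 'r(A) = g by rewrite mxabelem.rank_mx_group mul1n.
have OA : 'Ohm_1(A) = 'Mho^e(A).
  rewrite (homocyclic_Ohm_Mho 1 pA (mxabelem.mx_group_homocyclic _ _ _)).
  by rewrite mxabelem.exponent_mx_group // pfactorK // subn1.
have OK : 'Ohm_1(K) = 'Mho^e(A) :&: K.
  rewrite -OA (OhmEabelian pK) ?(abelianS (Ohm_sub _ _)) //.
  rewrite (OhmEabelian pA) ?(abelianS (Ohm_sub _ _)) //.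
  by apply/setP=> v; rewrite !inE andbC.
(* Restricted to ['Mho^e(A)], the map [h] has kernel ['Ohm_1(K)] and image ['Mho^e(G)]; compare
   orders. *)
have := LagrangeI 'Mho^e(A) K; rewrite -OK.
have -> : #|'Mho^e(A) : K| = #|'Mho^e(G)|.
  rewrite -imh -morphim_Mho ?subsetT // card_morphim kh.
  by rewrite (setIidPr _) ?subsetT.
move=> /=; rewrite -OA => /(congr1 (logn p)); rewrite lognM ?cardG_gt0 //.
by rewrite -!rank_abelian_pgroup // rA.
Qed.

(** * Evaluation of the measure *)

(** The Frattini condition in [Sab] is automatic: the quotient has the same rank g as the whole
    group, so the relations lie in the Frattini subgroup. *)
Lemma Sab_presentations p e g (gT : finGroupType) (G : {group gT}) :
  prime p -> 'r(G) = g ->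
  Sab p g e.+1 G = [set v : {ffun 'I_g.+1 -> 'rV['Z_(p ^ e.+1)]_g} |
      [set: 'rV['Z_(p ^ e.+1)]_g] / <<[set v i | i in 'I_g.+1]>> \isog G].
Proof.
move=> p_pr rG; apply/setP=> v; rewrite !inE; apply: andb_idl => isoG.
apply/forallP=> i.
have pA : p.-group [set: 'rV['Z_(p ^ e.+1)]_g] by apply: rV_Zp_pgroup.
apply: (subsetP (Phi_sub_rank_quotient pA (R := <<[set v i | i in 'I_g.+1]>>) _ _ _)).
- exact: FinRing.zmod_abelian.
- exact: subsetT.
- by rewrite (isog_rank isoG) rG mxabelem.rank_mx_group mul1n.
by rewrite mem_gen //; apply/imsetP; exists i.
Qed.

Local Open Scope ring_scope.

(** One formula serves c' = c and c' > c, with c' = e + 1: the difference [g - logn p #|'Mho^e(G)|]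
    is the rank of every kernel. *)
Lemma Meas_ab_pgroup p e g (gT : finGroupType) (G : {group gT}) :
  prime p -> (0 < g)%N -> abelian G -> (p.-group G)%g -> (exponent G %| p ^ e.+1)%N ->
  'r(G)%g = g ->
  Meas_ab p g e.+1 G =
  ((#|Aut G| * #|G|)%:R^-1 * (p ^ (g * g.+1))%:R * \prod_(1 <= k < g.+1) (1 - p%:R ^- k)) *
  \prod_(g.+2 - (g - logn p #|'Mho^e(G)%g|) <= k < g.+2) (1 - p%:R ^- k).
Proof.
move=> p_pr g_gt0 cGG pG eG rG; rewrite /Meas_ab (Sab_presentations _ p_pr rG).
set S := [set v | _]; set P2 := \prod_(_ - _ <= k < _) _.
set P1 := \prod_(1 <= k < _) _.
have q1 : (1 < p ^ e.+1)%N by rewrite -(exp1n e.+1) ltn_exp2r ?prime_gt1.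
have G0 : (#|G|%:R : rat) != 0 by rewrite pnatr_eq0 -lt0n cardG_gt0.
have A0 : (#|Aut G|%:R : rat) != 0 by rewrite pnatr_eq0 -lt0n cardG_gt0.
have p0 : (p%:R : rat) != 0 by rewrite pnatr_eq0 -lt0n prime_gt0.
have pA : (p.-group [set: 'rV['Z_(p ^ e.+1)]_g])%g by apply: rV_Zp_pgroup.
have cAA : abelian [set: 'rV['Z_(p ^ e.+1)]_g] by apply: FinRing.zmod_abelian.
have cardS : #|S|%:R * #|Aut G|%:R =
    (#|G| ^ g)%:R * P1 * (((p ^ e.+1) ^ g)%:R / #|G|%:R) ^+ g.+1 * P2 :> rat.
  rewrite -natrM (card_presentations _ _ cGG eG q1) natr_sum.
  (* Order and rank of the kernel do not depend on [t], so all summands agree. *)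
  rewrite (eq_bigr (fun=> (((p ^ e.+1) ^ g)%:R / #|G|%:R) ^+ g.+1 * P2)); last first.
    move=> t Gt; have [h [_ kh imh]] := gentuples_morphism cGG eG q1 Gt.
    have [cK rK] := card_rank_tuple_ker p_pr g_gt0 cGG eG Gt (K := 'ker h) kh.
    have pK := pgroupS (subsetT ('ker h)) pA.
    have cKK := abelianS (subsetT ('ker h)) cAA.
    rewrite -kh (card_gentuples_pgroup p_pr pK cKK); last first.
      by rewrite (canRL (addnK _) rK) leqW ?leq_subr.
    rewrite -cK natrM mulfK // natrX; congr (_ * _).
    by rewrite (canRL (addnK _) rK).
  (* For g-tuples generating [G], of rank g, the product starts at g + 1 - g = 1. *)
  rewrite sumr_const -[LHS]mulr_natl (card_gentuples_pgroup p_pr) ?rG // subSnn.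
  by rewrite !mulrA.
(* With A the whole group, |A| / |Phi(A)| = p^g; its power g + 1 is the factor p^(g(g+1)). *)
have cPhi : (#|'Phi([set: Fab p g e.+1])|%g * p ^ g = (p ^ e.+1) ^ g)%N.
  have := card_Phi_abelian pA cAA.
  by rewrite mxabelem.rank_mx_group mul1n card_rV_Zp.
have : (#|'Phi([set: Fab p g e.+1])|%:R : rat) != 0 by rewrite pnatr_eq0 -lt0n cardG_gt0.
move: cardS; rewrite -cPhi => /(canRL (mulfK A0)) ->.
rewrite natrM !natrX [(_ * _)%:R]natrM exprM.
move: #|'Phi(_)| => x x0; rewrite !exprMn exprVn [#|G|%:R ^+ g.+1]exprS.
by field; rewrite A0 G0 ?expf_neq0.
Qed.

Local Close Scope ring_scope.

Lemma gen_rank_abelian (gT : finGroupType) (G : {group gT}) g :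
  abelian G -> has_gen_rank G g -> 'r(G) = g.
Proof.
move=> cGG [[X [cX genX]] minX]; rewrite -grank_abelian //; apply/eqP.
rewrite eqn_leq -{1}cX -{1}genX grank_min /=.
by have [Y genY <-] := grank_witness G; apply: minX.
Qed.

Theorem theorem2p19 (p g c : nat) (gT : finGroupType) (G : {group gT}) :
  prime p -> odd p -> (1 <= g)%N ->
  abelian G -> p.-group G -> has_pclass p G c -> has_gen_rank G g ->
  let u := count (fun m => (m < p ^ c)%N) (abelian_type G) in
  let C : rat :=
    ((#|Aut G| * #|G|)%:R^-1 * (p ^ (g * g.+1))%:R *
     \prod_(1 <= k < g.+1) (1 - (p%:R)^-k))%R in
  (Meas_ab p g c G = C * \prod_(g.+2 - u <= k < g.+2) (1 - (p%:R : rat)^-k))%R /\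
  (forall c' : nat, (c < c')%N ->
     Meas_ab p g c' G = C * \prod_(2 <= k < g.+2) (1 - (p%:R : rat)^-k))%R.
Proof.
move=> p_pr _ g_gt0 cGG pG [Pc Pn] /(gen_rank_abelian cGG) rG u C.
have exponentG e : c <= e.+1 -> (exponent G %| p ^ e.+1)%N.
  move=> le_ce; apply/exponentP=> x Gx; apply/set1gP.
  rewrite -Pc lower_pcentral_abelian //; apply: (subsetP (Mho_leq G le_ce)).
  exact: Mho_p_elt (mem_p_elt pG Gx).
split=> [|[//|e] lt_ce]; last first.
  (* For c' = e + 1 > c we have e >= c, so ['Mho^e(G)] is trivial and every kernel has rank g. *)
  rewrite (Meas_ab_pgroup p_pr) ?exponentG ?(ltnW lt_ce) // (_ : 'Mho^e(G) = 1).
    by rewrite cards1 logn1 subn0 (_ : g.+2 - g = 2)%N // -addn2 addKn.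
  apply/trivgP; rewrite -Pc lower_pcentral_abelian //; exact: Mho_leq.
case: c @u Pc Pn exponentG => [|e] u Pc Pn exponentG.
  (* Class 0 would make [G] trivial, against its rank g >= 1. *)
  have G1 : G :=: 1 by [].
  by move: g_gt0; rewrite -rG G1 rank1.
rewrite lower_pcentral_abelian // in Pc.
rewrite (Meas_ab_pgroup p_pr) ?exponentG //.
(* Here c = e + 1, and u is g minus the number of cyclic factors of full order p^c. *)
suff -> : (g - logn p #|'Mho^e(G)| = u)%N by [].
by rewrite -rG -(count_abelian_type_lt p_pr pG cGG Pc) addnK.
Qed.
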